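(* Let $R$ be an Artinian commutative ring such that $|R|\le\mathfrak{c}$ and let $\lambda$ be an infinite cardinal. Then $R^{\lambda}$ is a free $R$-module and $\dim_R(R^{\lambda})=2^{\lambda}$.
   Context: Rings are unital and non-zero; $\mathfrak{c}=2^{\aleph_0}$. $R^{\lambda}$ is the direct product of $\lambda$ copies of $R$ (functions $\lambda\to R$), which is isomorphic to the dual of the free module $R^{[\lambda]}$, the direct sum of $\lambda$ copies of $R$. For a free $R$-module $M$, $\dim_R(M)=\kappa$ means $M\cong_R R^{[\kappa]}$. *)

(* Defs.v *)
From mathcomp Require Import all_boot all_algebra.
From mathcomp Require Import boolp classical_sets functions cardinality.
From mathcomp Require Export monalg.

Set Implicit Arguments.
Unset Strict Implicit.
Unset Printing Implicit Defensive.

Local Open Scope ring_scope.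

(* Descending chain condition on ideals: [R^o] is R as a module over itself,
   and its submodules are the ideals of R, the unit ideal included (which
   [idealr_closed] would rule out). *)
Definition artinian (R : comNzRingType) : Prop :=
  forall I : nat -> {pred R^o},
    (forall n, GRing.submod_closed (I n)) ->
    (forall n, {subset I n.+1 <= I n}) ->
    exists N, forall n, (N <= n)%N -> I n =i I N.

(* [{malg R[K]}] consists of the finitely supported functions K -> R, so as an
   R-module it is the direct sum of copies of R indexed by K. The type K stands
   for its cardinal: up to isomorphism the module depends on nothing else. *)
Definition has_dim (R : comNzRingType) (M : lmodType R) (K : choiceType) : Prop :=
  exists f : {linear {malg R[K]} -> M}, bijective f.

Definition free_module (R : comNzRingType) (M : lmodType R) : Prop :=
  exists K : choiceType, has_dim M K.

(* Main.v *)
(**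
An Artinian ring [R] has a composition series [0 = I_0 < ... < I_n = R] of
ideals with [I_(j+1) = I_j + R a_j] and [m_j = (I_j : a_j)] maximal. Since
[|R| <= c], the vector space [(R / m_j)^L] has at most [2^L] elements, and
[2^L] of them are linearly independent, namely the indicators of suitable
subsets of [L]; so it has a basis indexed by [2^L]. By the Chinese remainder
theorem there is one family [x], indexed by [2^L], in [R^L] which reduces to
such a basis modulo every [m_j]. This [x] is a basis of [R^L]:
- the coefficients of a linear relation lie in [I_n = R], and if they lie in
  [I_(j+1)], then they lie in [I_j], by independence modulo [m_j]; so they
  vanish;
- by induction on [j], the span of [x] contains [I_j^L]: an element of
  [I_(j+1)^L] is [a_j z] modulo [I_j^L], and modulo [m_j^L] the factor [z] is
  in the span.
*)

From HB Require Import structures.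
Require Import Defs.
From mathcomp Require Import all_boot all_algebra.
From mathcomp Require Import finmap.
From mathcomp Require Import boolp classical_sets functions cardinality.

Set Implicit Arguments.
Unset Strict Implicit.
Unset Printing Implicit Defensive.

Import GRing.Theory.

Local Open Scope classical_set_scope.
Local Open Scope card_scope.
Local Open Scope ring_scope.

(** * Comparability of cardinals *)

Lemma bigcup_total_on2 {T} (F : set (set T)) x y :
  total_on F subset -> (\bigcup_(X in F) X) x -> (\bigcup_(X in F) X) y ->
  exists2 X, F X & X x /\ X y.
Proof.
move=> totF [X FX Xx] [Y FY Yy].
by case: (totF X Y FX FY) => sXY; [exists Y | exists X] => //; split=> //; apply: sXY.
Qed.

(** Zorn's lemma gives a maximal graph [G] of a partial injection from [A] to [B]. It exhausts [A]
    or [B], as an unmatched element on each side would give a pair to add. *)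
Lemma card_le_total {T U} (A : set T) (B : set U) : A #<= B \/ B #<= A.
Proof.
elim/Ppointed: U => U in B *; first by right; rewrite !emptyE.
elim/Ppointed: T => T in A *; first by left; rewrite !emptyE.
pose P (G : set (T * U)) := [/\ forall p, G p -> A p.1 /\ B p.2,
  forall a b b', G (a, b) -> G (a, b') -> b = b' &
  forall a a' b, G (a, b) -> G (a', b) -> a = a'].
have [F sFP totF|G [[GAB Gf Gi] Gmax]] := @Zorn_bigcup _ P.
  split=> [p [X FX Xp]|a b b' Fb Fb'|a a' b Fa Fa'].
  - by have [+ _ _] := sFP X FX; apply.
  - have [X FX [Xb Xb']] := bigcup_total_on2 totF Fb Fb'.
    by have [_ + _] := sFP X FX; apply; [exact: Xb | exact: Xb'].
  - have [X FX [Xb Xb']] := bigcup_total_on2 totF Fa Fa'.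
    by have [_ _ +] := sFP X FX; apply; [exact: Xb | exact: Xb'].
case: (pselect (forall a, A a -> exists b, G (a, b))) => [Gl|].
  have /choice[h hG] : forall a, exists b, A a -> G (a, b).
    move=> a; case: (pselect (A a)) => [/Gl[b]|nAa]; first by exists b.
    by exists point.
  left; apply/pcard_leP/injfunPex; exists h => [a Aa|a a'].
    exact: (GAB _ (hG a Aa)).2.
  by rewrite !inE => /hG Ga /hG Ga' haa'; apply: Gi Ga _; rewrite haa'.
move/existsNP => [a /not_implyP[Aa /forallNP nGa]].
case: (pselect (forall b, B b -> exists a, G (a, b))) => [Gr|].
  have /choice[h hG] : forall b, exists a, B b -> G (a, b).
    move=> b; case: (pselect (B b)) => [/Gr[c]|nBb]; first by exists c.
    by exists point.
  right; apply/pcard_leP/injfunPex; exists h => [b Bb|b b'].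
    exact: (GAB _ (hG b Bb)).1.
  by rewrite !inE => /hG Gb /hG Gb' hbb'; apply: Gf Gb _; rewrite hbb'.
move/existsNP => [b /not_implyP[Bb /forallNP nGb]].
case: (Gmax (G `|` [set (a, b)])).
  by split=> [p|/(_ (a, b))]; [left | move=> /(_ (or_intror erefl)) /nGa].
split=> [p [/GAB//|->//]|x y y' [Gy|[-> ->]] [Gy'|]|x x' y [Gy|[-> ->]] [Gy'|]].
- exact: Gf Gy Gy'.
- by move=> [xa _]; case: (nGa y); rewrite -xa.
- by case: (nGa y').
- by case.
- exact: Gi Gy Gy'.
- by move=> [_ yb]; case: (nGb x); rewrite -yb.
- by case: (nGb x').
- by case.
Qed.

Lemma infinite_nat_inj {T : Type} : infinite_set [set: T] ->
  exists i : nat -> T, injective i.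
Proof.
move=> Tinf; have [x0 _] := infinite_setN0 Tinf.
pose Tp := HB.pack_for pointedType T
  (isPointed.Build T x0) (gen_eqMixin T) (gen_choiceMixin T).
have /infiniteP/(@pcard_injP nat Tp)[i inj_i] := Tinf.
by exists i => m n; apply: inj_i; rewrite inE.
Qed.

(** * Squares of infinite sets *)

Section square.
Context {T : Type}.
Implicit Types (G : set (T * T * T)) (a b c d : T) (p q : T * T).

(** For the graph [G] of a map on a square [A * A], this recovers [A] from the diagonal, so that
    Zorn's lemma can work with [G] alone. *)
Let field G a := exists c, G ((a, a), c).

Let square_graph G := [/\
  forall a b c, G ((a, b), c) -> [/\ field G a, field G b & field G c],
  forall a b, field G a -> field G b -> exists c, G ((a, b), c),
  forall p c c', G (p, c) -> G (p, c') -> c = c' &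
  forall p p' c, G (p, c) -> G (p', c) -> p = p'].

(** A pairing of natural numbers, carried along an embedding of [nat], is the starting point for
    Zorn's lemma. *)
Let square_graph_nat : infinite_set [set: T] ->
  exists2 G, square_graph G & exists i : nat -> T, injective i /\ forall n, field G (i n).
Proof.
move=> /infinite_nat_inj[i inj_i].
have /card_eqPle[/pcard_injP[j inj_j] _] := card_nat2.
have {}inj_j : injective j by move=> m n; apply: inj_j; rewrite inE.
pose G := [set z | exists m n, z = ((i m, i n), i (j (m, n)))].
have Gi m : field G (i m) by exists (i (j (m, m))), m, m.
exists G; last by exists i.
split=> [a b c [m [n [-> -> ->]]]//|a b [? [m [_ [-> _ _]]]] [? [n [_ [-> _ _]]]]|p c c'|p p' c].
- by exists (i (j (m, n))), m, n.
- by move=> [m [n [-> ->]]] [m' [n' [/inj_i-> /inj_i-> ->]]].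
- by move=> [m [n [-> ->]]] [m' [n' [-> /inj_i/inj_j[-> ->]]]].
Qed.

(* Zorn's lemma on partial injections [A * A -> A] with [A] infinite. If a
   maximal one had a disjoint copy of [A] outside [A], this copy could house
   the three missing quarters of the square of [A] and its copy. Hence the
   complement of [A] embeds in [A], and [T] embeds in [A * A]. *)
Lemma infinite_square : infinite_set [set: T] ->
  exists f : T * T -> T, injective f.
Proof.
move=> /square_graph_nat[G0 [G0f G0t G0fun G0inj] [i [inj_i fG0i]]].
(* Joining [G0] makes the field of a maximal graph infinite; the empty chain yields [G0] itself. *)
pose P G := square_graph (G0 `|` G).
have fieldU G a : field G0 a -> field (G0 `|` G) a by move=> [c]; exists c; left.
have [F sFP totF|G [sqG Gmax]] := @Zorn_bigcup _ P.
  have bigcupU z w : (G0 `|` \bigcup_(X in F) X) z -> (G0 `|` \bigcup_(X in F) X) w ->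
      exists G, [/\ square_graph G, G z, G w & G `<=` G0 `|` \bigcup_(X in F) X].
    have sU X : F X -> G0 `|` X `<=` G0 `|` \bigcup_(X in F) X.
      by move=> FX u [|Xu]; [left | right; exists X].
    move=> [G0z|Fz] [G0w|Fw].
    - by exists G0; split=> // u; left.
    - case: Fw => X FX Xw; exists (G0 `|` X).
      by split; [exact: sFP | left | right | exact: sU].
    - case: Fz => X FX Xw; exists (G0 `|` X).
      by split; [exact: sFP | right | left | exact: sU].
    - have [X FX [Xz Xw]] := bigcup_total_on2 totF Fz Fw; exists (G0 `|` X).
      by split; [exact: sFP | right | right | exact: sU].
  have fieldS G G' a : G `<=` G' -> field G a -> field G' a.
    by move=> sGG' [c /sGG']; exists c.
  split=> [a b c Gc|a b [c Gc] [d Gd]|p c c' Gc Gc'|p p' c Gp Gp'].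
  - have [H [[Hf _ _ _] Hc _ sH]] := bigcupU _ _ Gc Gc.
    by have [? ? ?] := Hf _ _ _ Hc; split; apply: fieldS sH _.
  - have [H [[_ Ht _ _] Hc Hd sH]] := bigcupU _ _ Gc Gd.
    have [||e He] := Ht a b; [by exists c | by exists d |].
    by exists e; apply: sH.
  - have [H [[_ _ + _] Hc Hc' _]] := bigcupU _ _ Gc Gc'.
    by apply; [exact: Hc | exact: Hc'].
  - have [H [[_ _ _ +] Hp Hp' _]] := bigcupU _ _ Gp Gp'.
    by apply; [exact: Hp | exact: Hp'].
move: sqG Gmax; rewrite /P; set H := G0 `|` G => -[Hf Ht Hfun Hinj] Gmax.
pose A := field H.
have [t [inj_t At]] : exists t : nat -> T, injective t /\ forall n, A (t n).
  by exists i; split=> // n; apply: fieldU.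
have /choice[f fH] : forall p, exists c, A p.1 -> A p.2 -> H (p, c).
  case=> a b; case: (pselect (A a /\ A b)) => [[Aa Ab]|nAB].
    by have [c Hc] := Ht a b Aa Ab; exists c.
  by exists (t 0%N) => Aa Ab; case: nAB.
have fA a b : A a -> A b -> A (f (a, b)).
  by move=> Aa Ab; have [] := Hf _ _ _ (fH (a, b) Aa Ab).
have f_inj a b a' b' : A a -> A b -> A a' -> A b' ->
    f (a, b) = f (a', b') -> a = a' /\ b = b'.
  move=> Aa Ab Aa' Ab' ff'; have := fH (a', b') Aa' Ab'.
  by rewrite -ff' => /(Hinj _ _ _ (fH (a, b) Aa Ab)) [].
pose Tp := HB.pack_for pointedType T
  (isPointed.Build T (t 0%N)) (gen_eqMixin T) (gen_choiceMixin T).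
case: (card_le_total A (~` A)) => [AC|CA]; last first.
  have /(@pcard_leP T Tp)/injfunPex[k kA inj_k] := CA.
  (* The tags [t 0] and [t 1] keep the images of [A] and of its complement apart, so [w] embeds the
     whole type in [A]. *)
  pose w a := if pselect (A a) then f (a, t 0%N) else f (k a, t 1%N).
  have Aw a : A (w a).
    by rewrite /w; case: pselect => Aa; apply: fA => //; apply: kA.
  have inj_w : injective w.
    move=> a b; rewrite /w.
    case: pselect => Aa; case: pselect => Ab /f_inj[]//; do ?exact: kA.
    - by move=> _ /inj_t.
    - by move=> _ /inj_t.
    - by move=> + _; apply: inj_k; rewrite inE.
  exists (fun p => f (w p.1, w p.2)) => -[a b] [a' b'] /= /f_inj[] // /inj_w-> /inj_w->//.
have /(@pcard_leP T Tp)/injfunPex[h hA inj_h] := AC.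
exfalso.
have {}inj_h a b : A a -> A b -> h a = h b -> a = b.
  by move=> Aa Ab; apply: inj_h; rewrite inE.
(* [u false] is the inclusion of [A], and [u true] maps [A] onto its copy in the complement. *)
pose u (x : bool) a := if x then h a else a.
have u_inj x y a b : A a -> A b -> u x a = u y b -> x = y /\ a = b.
  move: x y => [] [] Aa Ab //= => [/inj_h->//|hb|hb].
    by case: (hA a Aa); rewrite /= hb.
  by case: (hA b Ab); rewrite /= -hb.
(* The value on the quarter [(x, y)] of the enlarged square lies in the copy of [A]; the number
   [x + 2 y] separates the values of different quarters. *)
pose v (x y : bool) a b := h (f (f (a, b), t (x + y.*2)%N)).
have v_inj x y a b x' y' a' b' : A a -> A b -> A a' -> A b' ->
    v x y a b = v x' y' a' b' -> [/\ x = x', y = y', a = a' & b = b'].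
  move=> Aa Ab Aa' Ab' /(inj_h _ _ (fA _ _ (fA _ _ Aa Ab) (At _))
    (fA _ _ (fA _ _ Aa' Ab') (At _))).
  move=> /(f_inj _ _ _ _ (fA _ _ Aa Ab) (At _) (fA _ _ Aa' Ab') (At _))[].
  move=> /(f_inj _ _ _ _ Aa Ab Aa' Ab')[-> ->] /inj_t.
  by move: x x' y y' => [] [] [] [].
have nAv x y a b : A a -> A b -> ~ A (v x y a b).
  by move=> Aa Ab; apply: hA; do ?[apply: (fA)].
pose E := [set z | exists x y a b,
  [/\ A a, A b, x || y & z = ((u x a, u y b), v x y a b)]].
have HGE : G0 `|` (G `|` E) = H `|` E by rewrite setUA.
have HE_field x a : A a -> field (H `|` E) (u x a).
  case: x => Aa /=; last by case: Aa => c Hc; exists c; left.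
  by exists (v true true a a); right; exists true, true, a, a.
have field_HE a : field (H `|` E) a -> exists x b, A b /\ a = u x b.
  case=> c [Ha|]; first by exists false, a; split=> //; exists c.
  by case=> x [y [b [_ [Ab _ _ [-> _ _]]]]]; exists x, b.
have HA a b c : H ((a, b), c) -> [/\ A a, A b & A c] by exact: Hf.
case: (Gmax (G `|` E)).
  split=> [z|/(_ ((h (t 0%N), h (t 0%N)), v true true (t 0%N) (t 0%N)))]; first by left.
  have Et : E ((h (t 0%N), h (t 0%N)), v true true (t 0%N) (t 0%N)).
    by exists true, true, (t 0%N), (t 0%N).
  by move=> /(_ (or_intror Et)) Gh; have [/(hA _ (At 0%N))] := HA _ _ _ (or_intror Gh).
rewrite /P HGE; split.
- move=> a b c [/HA[Aa Ab Ac]|[x [y [a' [b' [Aa Ab xy [-> -> ->]]]]]]].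
    by split; [exact: (HE_field false a) | exact: (HE_field false b) |
               exact: (HE_field false c)].
  split; [exact: HE_field | exact: HE_field |].
  by apply: (HE_field true); do ?[apply: (fA)].
- move=> a b /field_HE[x [a' [Aa ->]]] /field_HE[y [b' [Ab ->]]].
  case xy: (x || y); first by exists (v x y a' b'); right; exists x, y, a', b'.
  move: x y xy => [] [] //= _; have [c Hc] := Ht _ _ Aa Ab.
  by exists c; left.
- move=> [a b] c c' [Hc|[x [y [a1 [b1 [Aa Ab xy [ea eb ->]]]]]]].
    case=> [/(Hfun _ _ _ Hc)//|[x [y [a1 [b1 [Aa Ab xy [ea eb _]]]]]]].
    have [A1 A2 _] := HA _ _ _ Hc; move: xy.
    have [<- _] := u_inj false x _ _ A1 Aa ea.
    by have [<-] := u_inj false y _ _ A2 Ab eb.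
  case=> [Hc|[x' [y' [a' [b' [Aa' Ab' xy' [ea' eb' ->]]]]]]].
    have [A1 A2 _] := HA _ _ _ Hc; move: xy.
    have [<- _] := u_inj false x _ _ A1 Aa ea.
    by have [<-] := u_inj false y _ _ A2 Ab eb.
  have [-> ->] := u_inj _ _ _ _ Aa Aa' (etrans (esym ea) ea').
  by have [-> ->] := u_inj _ _ _ _ Ab Ab' (etrans (esym eb) eb').
- move=> [a b] [a' b'] c [Hc|[x [y [a1 [b1 [Aa Ab xy [-> -> ->]]]]]]].
    case=> [/(Hinj _ _ _ Hc)//|[x [y [a1 [b1 [Aa Ab xy [_ _ ec]]]]]]].
    by have [_ _] := HA _ _ _ Hc; rewrite ec => /(nAv _ _ _ _ Aa Ab).
  case=> [Hc|[x' [y' [a2 [b2 [Aa' Ab' xy' [-> -> ec]]]]]]].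
    by have [_ _ /(nAv _ _ _ _ Aa Ab)] := HA _ _ _ Hc.
  by have [-> -> -> ->] := v_inj _ _ _ _ _ _ _ _ Aa Ab Aa' Ab' ec.
Qed.

End square.

(** * Counting words and functions over an infinite set *)

Lemma injective_left_inverse {A B : Type} (f : A -> B) : inhabited A -> injective f ->
  exists g : B -> A, cancel f g.
Proof.
move=> [a0] inj_f.
have /choice[g gP] : forall b, exists a, (exists a', f a' = b) -> f a = b.
  by move=> b; case: (pselect (exists a', f a' = b)) => [[a fab]|nb];
    [exists a | exists a0].
by exists g => a; apply: inj_f; apply: gP; exists a.
Qed.

(** A word is coded by its length and a nested pairing of its letters; the pairing alone need not
    separate words of different lengths. Over [L] the words serve as finite partial functions to
    [bool]. *)
Lemma infinite_surj_seq {T : Type} : infinite_set [set: T] ->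
  exists g : T -> seq (T * bool), forall s, exists x, g x = s.
Proof.
move=> Tinf; have [f inj_f] := infinite_square Tinf.
have [i inj_i] := infinite_nat_inj Tinf.
pose b2n (b : bool) : nat := b.
pose code := foldr (fun p x => f (f (p.1, i (b2n p.2)), x)) (i 0%N).
have code_inj s s' : size s = size s' -> code s = code s' -> s = s'.
  elim: s s' => [|[x b] s IHs] [|[x' b'] s'] //= [/IHs{}IHs].
  by move=> /inj_f[/inj_f[-> /inj_i bb'] /IHs->]; case: b b' bb' => [] [].
have [||g gK] := @injective_left_inverse (seq (T * bool)) T (fun s => f (i (size s), code s)).
- by exists; exact: nil.
- by move=> s s' /inj_f[/inj_i + cs] => /code_inj; apply.
by exists g => s; exists (f (i (size s), code s)).
Qed.

Lemma infinite_surj_natX {T : Type} : infinite_set [set: T] ->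
  exists g : T -> nat * T, forall p, exists x, g x = p.
Proof.
move=> Tinf; have [f inj_f] := infinite_square Tinf.
have [i inj_i] := infinite_nat_inj Tinf.
have [||g gK] := @injective_left_inverse (nat * T) T (fun p => f (i p.1, p.2)).
- by exists; exact: (0%N, i 0%N).
- by move=> [m x] [n y] /inj_f[/inj_i/= -> ->].
by exists g => p; exists (f (i p.1, p.2)).
Qed.

(** A function from [L] to bit sequences is a set of pairs in [nat * L], and pulling back along a
    surjection from [L] to [nat * L] embeds these sets in the subsets of [L]. *)
Lemma fun_card_le {L R : Type} : infinite_set [set: L] ->
  [set: R] #<= [set: nat -> bool] ->
  exists f : (L -> R) -> (L -> bool), injective f.
Proof.
move=> /infinite_surj_natX[g gP] /pcard_injP[i inj_i].
exists (fun h x => i (h (g x).2) (g x).1) => h h' /funeqP hh'.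
apply/funext => x; apply: inj_i; rewrite ?inE //.
by apply/funext => n; have [z gz] := gP (n, x); have := hh' z; rewrite gz.
Qed.

(** * Maximal ideals and the Chinese remainder theorem *)

Section ideals.
Context {R : comNzRingType}.
Implicit Types (I J U m : set R) (a b r x y z : R).

Definition ideal I := I 0 /\ forall a x y, I x -> I y -> I (a * x + y).

Definition ideal_adjoin I a := [set x | exists2 r, True & I (x - r * a)].

(** The annihilator of the class of [a] modulo the ideal [I]. *)
Definition colon I a := [set r | I (r * a)].

(** Maximality is stated as the quotient being a field: [r] is an inverse of [x] modulo [m]. *)
Definition maximal_ideal m :=
  [/\ ideal m, ~ m 1 & forall x, ~ m x -> exists r, m (1 - r * x)].

Lemma idealM I a x : ideal I -> I x -> I (a * x).
Proof. by move=> [I0 Il] Ix; rewrite -[a * x]addr0; apply: Il. Qed.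

Lemma idealD I x y : ideal I -> I x -> I y -> I (x + y).
Proof. by move=> [I0 Il] Ix Iy; rewrite -[x]mul1r; apply: Il. Qed.

Lemma idealN I x : ideal I -> I x -> I (- x).
Proof. by move=> idI Ix; rewrite -mulN1r; apply: idealM. Qed.

Lemma idealB I x y : ideal I -> I x -> I y -> I (x - y).
Proof. by move=> idI Ix Iy; apply: idealD => //; apply: idealN. Qed.

Lemma idealBl I x y : ideal I -> I (x - y) -> I x -> I y.
Proof.
by move=> idI Ixy Ix; rewrite -[y](subKr x); apply: idealB.
Qed.

Lemma idealBr I x y : ideal I -> I (x - y) -> I y -> I x.
Proof. by move=> idI Ixy Iy; rewrite -[x](subrK y); apply: idealD. Qed.

Lemma ideal_sum I (K : eqType) (s : seq K) (F : K -> R) :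
  ideal I -> (forall k, k \in s -> I (F k)) -> I (\sum_(k <- s) F k).
Proof.
move=> idI IF; rewrite big_seq; elim/big_ind: _ => //; first by case: idI.
by move=> x y; apply: idealD.
Qed.

Lemma ideal_set0 : ideal [set 0].
Proof. by split=> // a x y /= -> ->; rewrite mulr0 addr0. Qed.

Lemma ideal_adjoinP I a : ideal I -> ideal (ideal_adjoin I a).
Proof.
move=> idI; split=> [|b x y [r _ Ir] [s _ Is]].
  by exists 0; rewrite // mul0r subr0; case: idI.
exists (b * r + s) => //.
have -> : b * x + y - (b * r + s) * a = b * (x - r * a) + (y - s * a).
  by rewrite mulrBr mulrDl mulrA opprD addrACA.
by apply: idI.2.
Qed.

Lemma sub_ideal_adjoin I a : I `<=` ideal_adjoin I a.
Proof. by move=> x Ix; exists 0; rewrite // mul0r subr0. Qed.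

Lemma mem_ideal_adjoin I a : ideal I -> ideal_adjoin I a a.
Proof. by move=> idI; exists 1; rewrite // mul1r subrr; case: idI. Qed.

Lemma ideal_adjoin_sub I J a : ideal J -> I `<=` J -> J a -> ideal_adjoin I a `<=` J.
Proof.
move=> idJ sIJ Ja x [r _ Ixr]; apply: (idealBr idJ (sIJ _ Ixr)).
exact: idealM.
Qed.

Lemma maximal_ideal_prime m x y : maximal_ideal m -> m (x * y) -> ~ m x -> m y.
Proof.
move=> [idm _ mmax] mxy /mmax[r mrx].
rewrite -[y]mul1r -(subrK (r * x) 1) mulrDl; apply: idealD => //.
  by rewrite mulrC; apply: idealM.
by rewrite -mulrA; apply: idealM.
Qed.

Lemma maximal_ideal_inj m m' : maximal_ideal m -> maximal_ideal m' ->
  m `<=` m' -> m = m'.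
Proof.
move=> [idm m1 mmax] [idm' m'1 m'max] smm'; apply/seteqP; split=> // x m'x.
apply: contrapT => /mmax[r /smm' m'r]; apply: m'1.
by apply: (idealBr idm' m'r); apply: idealM.
Qed.

(** Induction on [ms]: a solution for the tail is corrected at [m] by an element [e] of all the
    other ideals outside [m], a product that avoids [m] by primality. The residues [v] are indexed
    by ideals, not positions, since a composition series may repeat a factor. *)
Lemma chinese_maximal (ms : seq (set R)) (v : set R -> R) :
  (forall m, m \in ms -> maximal_ideal m) ->
  exists x, forall m, m \in ms -> m (x - v m).
Proof.
have avoid m (ns : seq (set R)) : maximal_ideal m -> m \notin ns ->
    (forall n, n \in ns -> maximal_ideal n) -> exists e, ~ m e /\ forall n, n \in ns -> n e.
  move=> mm; elim: ns => [_ _|n ns IHns]; first by exists 1; case: mm.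
  rewrite inE negb_or => /andP[/eqP mn mns] ns_max.
  have [|e [me ne]] := IHns mns.
    by move=> n' n'ns; apply: ns_max; rewrite inE n'ns orbT.
  have nn : maximal_ideal n by apply: ns_max; rewrite mem_head.
  have [x [nx mx]] : exists x, n x /\ ~ m x.
    apply: contra_notP mn => /forallNP nmx; apply/esym/maximal_ideal_inj => // x nx.
    by apply: contrapT => mx; apply: (nmx x).
  exists (e * x); split=> [mex|n']; first by apply: mx; apply: maximal_ideal_prime mex _.
  rewrite inE => /predU1P[->|n'ns]; first by apply: idealM => //; case: nn.
  rewrite mulrC; apply: idealM; last exact: ne.
  by have [] := ns_max n' _; rewrite // inE n'ns orbT.
elim: ms => [_|m ms IHms ms_max]; first by exists 0.
have mm : maximal_ideal m by apply: ms_max; rewrite mem_head.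
have [n nms|x xP] := IHms; first by apply: ms_max; rewrite inE nms orbT.
have [mms|mms] := boolP (m \in ms).
  by exists x => n; rewrite inE => /predU1P[->|]; apply: xP.
have [n nms|e [me eP]] := avoid _ _ mm mms.
  by apply: ms_max; rewrite inE nms orbT.
have [idm _ /(_ e me)[r mr]] := mm.
(* The product [r * e] is 1 modulo [m] and 0 modulo the other ideals. *)
exists (x - (x - v m) * (r * e)) => n; rewrite inE => /predU1P[->|nms].
  have -> : x - (x - v m) * (r * e) - v m = (x - v m) * (1 - r * e).
    by rewrite mulrBr mulr1 addrAC.
  exact: idealM.
have idn : ideal n by have [] := ms_max n _; rewrite // inE nms orbT.
rewrite addrAC; apply: idealB; [exact: idn | exact: xP |].
by rewrite mulrA; apply: idealM => //; apply: eP.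
Qed.

(** * Composition series of Artinian rings *)

(** The list [ms] records the annihilators of the factors, top factor first. The quotient of
    [ideal_adjoin I a] by [I] is isomorphic to that of the ring by [colon I a], hence simple. *)
Inductive composition_series : seq (set R) -> set R -> Prop :=
| composition_series0 : composition_series [::] [set 0]
| composition_series_adjoin ms I a : composition_series ms I ->
    maximal_ideal (colon I a) ->
    composition_series (colon I a :: ms) (ideal_adjoin I a).

Lemma composition_series_ideal ms I : composition_series ms I -> ideal I.
Proof.
by elim=> [|*]; [exact: ideal_set0 | exact: ideal_adjoinP].
Qed.

Lemma composition_series_maximal ms I m :
  composition_series ms I -> m \in ms -> maximal_ideal m.
Proof.
by elim=> // ms' J a _ IH maxJ; rewrite inE => /predU1P[->|].
Qed.

Let preimage_mul I x U := [set y | I y /\ U (x * y)].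

(** Multiplication by [x] maps the preimage onto [U], and the series [ms0] of its kernel is
    continued along that of [U]: adjoining [a] lifts to adjoining some [b] with [a = x * b], with
    the same colon ideal. *)
Lemma composition_series_preimage I x ms0 ms U : ideal I ->
  composition_series ms0 (preimage_mul I x [set 0]) ->
  composition_series ms U -> (forall u, U u -> exists2 y, I y & u = x * y) ->
  exists ms', composition_series ms' (preimage_mul I x U).
Proof.
move=> idI cs0; elim=> [_|ms' J a csJ IHJ maxJ JP]; first by exists ms0.
have idJ := composition_series_ideal csJ.
have [b Ib eab] := JP a (mem_ideal_adjoin a idJ).
have [|ms1 cs1] := IHJ; first by move=> u Ju; apply: JP; apply: sub_ideal_adjoin.
have colonE : colon (preimage_mul I x J) b = colon J a.
  apply/seteqP; split=> r; rewrite /colon /= eab.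
    by case=> _; rewrite mulrCA.
  by rewrite mulrCA => Jr; split=> //; apply: idealM.
have -> : preimage_mul I x (ideal_adjoin J a) = ideal_adjoin (preimage_mul I x J) b.
  apply/seteqP; split=> y.
    move=> [Iy [r _ Jr]]; exists r => //; split.
      by apply: idealB => //; apply: idealM.
    by rewrite mulrBr mulrCA -eab.
  move=> [r _ [Iyr Jyr]]; split; first by apply: (idealBr idI Iyr); apply: idealM.
  by exists r; rewrite // eab mulrCA -mulrBr.
by exists (colon J a :: ms1); rewrite -colonE; constructor; rewrite ?colonE.
Qed.

(** Without a minimal member, repeated choice of a strictly smaller one would give a descending
    chain that never becomes stationary. *)
Lemma artinian_minimal (P : set (set R)) : artinian R ->
  (forall I, P I -> ideal I) -> (exists I, P I) ->
  exists2 I, P I & forall J, P J -> J `<=` I -> J = I.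
Proof.
move=> artR idP [I0 PI0]; apply: contrapT => nmin.
have /choice[next nextP] : forall I, exists J, P I -> P J /\ (J `<=` I /\ J <> I).
  move=> I; case: (pselect (P I)) => [PI|nPI]; last by exists I.
  apply: contrapT => /forallNP nJ; apply: nmin; exists I => // J PJ sJI.
  by apply: contrapT => neqJI; apply: (nJ J).
pose I_ n := iter n next I0.
have PI_ n : P (I_ n) by elim: n => [|n IHn] //=; have [] := nextP _ IHn.
have [|n x|N IN] := artR (fun n => [pred x : R^o | `[< I_ n x >]]).
- move=> n; have [In0 Inl] := idP _ (PI_ n).
  split=> [|a x y]; rewrite !inE; first exact: In0.
  by move=> Ix Iy; apply: Inl.
- by rewrite !inE; have [_ [+ _]] := nextP _ (PI_ n); apply.
have [_ [sI nI]] := nextP _ (PI_ N); apply: nI.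
apply/seteqP; split=> // x Ix; have := IN N.+1 (leqnSn N) x.
by rewrite !inE; case: asboolP => // _; case: asboolP.
Qed.

(** This provides a hyperplane missing [y] when [I] is a vector space over a residue field. *)
Lemma maximal_avoiding I y : ideal I -> I y -> y != 0 ->
  exists J, [/\ ideal J, J `<=` I, ~ J y &
    forall J', ideal J' -> J' `<=` I -> J `<=` J' -> ~ J' y -> J' = J].
Proof.
move=> idI Iy y0.
(* Zero is adjoined because the union of the empty chain is empty, hence not an ideal. *)
pose P A := [/\ ideal (A `|` [set 0]), A `<=` I & ~ A y].
have [F sFP totF|J [[idJ sJI Jy] Jmax]] := @Zorn_bigcup _ P.
  split=> [|x [X FX Xx]|[X FX Xy]].
  - split=> [|a x z]; first by right.
    have idF X : F X -> ideal (X `|` [set 0]) by move=> /sFP[].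
    have sF X : F X -> X `|` [set 0] `<=` \bigcup_(X in F) X `|` [set 0].
      by move=> FX u [|->]; [left; exists X | right].
    move=> [Fx|->] [Fz|->]; rewrite ?mulr0 ?addr0 ?add0r.
    + have [X FX [Xx Xz]] := bigcup_total_on2 totF Fx Fz.
      by apply: (sF _ FX); apply: (idF _ FX).2; left.
    + case: Fx => X FX Xx; apply: (sF _ FX).
      by apply: idealM; [exact: idF | left].
    + by left.
    + by right.
  - by have [_ + _] := sFP X FX; apply.
  - by have [_ _] := sFP X FX.
have J0 : J 0.
  apply: contrapT => J0; case: (Jmax (J `|` [set 0])).
    by split=> [x|/(_ 0 (or_intror erefl))//]; left.
  split; first by rewrite -setUA setUid.
    by move=> x [/sJI//|->]; case: idI.
  by case=> // /eqP; apply/negP.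
have J0E : J `|` [set 0] = J by apply/setUidPl => x ->.
exists J; split=> //; first by rewrite -J0E.
move=> J' idJ' sJ'I sJJ' J'y; apply: contrapT => neqJ; apply: (Jmax J').
  by split=> // sJ'J; apply: neqJ; apply/seteqP.
split=> //; suff -> : J' `|` [set 0] = J' by [].
by apply/setUidPl => x ->; case: idJ'.
Qed.

(* Take an ideal [I] minimal among those without a composition series. An
   element [x] of the ring kills [I] or satisfies [x I = I], as otherwise both
   the kernel and the image of the multiplication by [x] on [I] would have
   composition series. So the annihilator [P] of [I] is a maximal ideal, and
   [I] is a vector space over [R/P]; a hyperplane of it has a composition
   series, hence so has [I]. *)
Theorem artinian_composition_series : artinian R ->
  exists ms, composition_series ms [set: R].
Proof.
move=> artR; apply: contrapT => nR.
pose Q I := ideal I /\ ~ exists ms, composition_series ms I.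
have [I [idI nI] Imin] : exists2 I, Q I & forall J, Q J -> J `<=` I -> J = I.
  apply: artinian_minimal => //; first by move=> I [].
  by exists [set: R].
have fin J : ideal J -> J `<=` I -> J <> I -> exists ms, composition_series ms J.
  by move=> idJ sJI neqJI; apply: contrapT => nJ; apply: neqJI; apply: Imin.
have [y Iy y0] : exists2 y, I y & y != 0.
  apply: contrapT => ny; apply: nI; exists [::].
  suff -> : I = [set 0] by constructor.
  apply/seteqP; split=> [y Iy|y ->]; last by case: idI.
  by apply: contrapT => /eqP y0; apply: ny; exists y.
have xI x : (forall z, I z -> x * z = 0) \/ (forall z, I z -> exists2 t, I t & z = x * t).
  pose K := preimage_mul I x [set 0].
  pose xI := [set z | exists2 t, I t & z = x * t].
  have idK : ideal K.
    split=> [|a z t [Iz xz0] [It xt0]]; first by split; [case: idI | rewrite mulr0].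
    by split; [apply: idI.2 | rewrite /= mulrDr mulrCA xz0 xt0 mulr0 addr0].
  have idxI : ideal xI.
    split=> [|a _ _ [z Iz ->] [t It ->]]; first by exists 0; [case: idI | rewrite mulr0].
    by exists (a * z + t); [apply: idI.2 | rewrite mulrDr mulrCA].
  case: (pselect (K = I)) => [KI|nKI]; first by left=> z; rewrite -KI => -[].
  case: (pselect (xI = I)) => [xII|nxII]; first by right=> z; rewrite -{1}xII.
  have [ms0 cs0] : exists ms, composition_series ms K by apply: fin => // z [].
  have [ms cs] : exists ms, composition_series ms xI.
    by apply: fin => // _ [z Iz ->]; apply: idealM.
  have [//|ms' cs'] := composition_series_preimage idI cs0 cs.
  exfalso; apply: nI; exists ms'; suff <- : preimage_mul I x xI = I by [].
  by apply/seteqP; split=> [z []//|z Iz]; split=> //; exists z.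
pose P := [set x | forall z, I z -> x * z = 0].
have maxP : maximal_ideal P.
  split.
  - split=> [z Iz|a r s Pr Ps z Iz]; first by rewrite mul0r.
    by rewrite mulrDl -mulrA Pr // Ps // mulr0 addr0.
  - by move=> /(_ y Iy); rewrite mul1r => /eqP; apply/negP.
  - move=> x nPx; have {nPx} xII : forall z, I z -> exists2 t, I t & z = x * t.
      by case: (xI x).
    have xnII n z : I z -> exists2 t, I t & z = x ^+ n * t.
      elim: n z => [|n IHn] z Iz; first by exists z; rewrite // expr0 mul1r.
      have [t /IHn[u Iu ->] ->] := xII z Iz.
      by exists u; rewrite // exprS mulrA.
    (* The ideals generated by the powers of [x] have a minimal member, so [x ^+ n = r * x ^+ n.+1]
       for some [n] and [r]. Then [1 - r * x] kills [x ^+ n * I], which is [I]. *)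
    have [J [n ->] Jmin] : exists2 J,
        exists n, J = [set z | exists r, z = r * x ^+ n] &
        forall J', (exists n, J' = [set z | exists r, z = r * x ^+ n]) ->
          J' `<=` J -> J' = J.
      apply: artinian_minimal => //.
        move=> _ [n ->]; split; first by exists 0; rewrite mul0r.
        by move=> a _ _ [r ->] [s ->]; exists (a * r + s); rewrite mulrDl mulrA.
      by eexists; exists 0%N.
    have [r er] : [set z | exists r, z = r * x ^+ n.+1] (x ^+ n).
      rewrite (Jmin [set z | _]); first by exists 1; rewrite mul1r.
        by exists n.+1.
      by move=> _ [r ->]; exists (r * x); rewrite exprS mulrA.
    exists r => z /(xnII n)[t It ->].
    by rewrite mulrBl mul1r [in X in X - _]er exprS !mulrA subrr.
have [J [idJ sJI nJy Jmax]] := maximal_avoiding idI Iy y0.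
have [ms cs] : exists ms, composition_series ms J.
  by apply: fin => // JI; apply: nJy; rewrite JI.
have colonE : colon J y = P.
  apply/seteqP; split=> r; last by move=> Pr; rewrite /colon /= Pr //; case: idJ.
  move=> Jry; apply: contrapT; case: (maxP) => _ _ + nPr.
  move=> /(_ r nPr)[s /(_ y Iy)]; rewrite mulrBl mul1r => /eqP.
  by rewrite subr_eq0 => /eqP ye; apply: nJy; rewrite ye -mulrA; apply: idealM.
apply: nI; exists (P :: ms).
suff -> : I = ideal_adjoin J y by rewrite -colonE; constructor; rewrite ?colonE.
apply/seteqP; split=> [z Iz|]; last exact: ideal_adjoin_sub.
case: (pselect (J z)) => [Jz|nJz]; first exact: sub_ideal_adjoin.
(* By maximality of [J], adjoining [z] captures [y]. The coefficient [r] of [z] is then invertible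
   modulo [P], and solving for [z] puts it in [J] with [y] adjoined. *)
have [r _ Jyrz] : ideal_adjoin J z y.
  apply: contrapT => nJzy; apply: nJz; rewrite -(Jmax (ideal_adjoin J z)) //.
  - exact: mem_ideal_adjoin.
  - exact: ideal_adjoinP.
  - exact: ideal_adjoin_sub.
  - exact: sub_ideal_adjoin.
have nPr : ~ P r by move=> Pr; apply: nJy; rewrite -[y]subr0 -(Pr z Iz).
have [_ _ /(_ r nPr)[s Ps]] := maxP; exists s => //.
have zE : s * (r * z) = z.
  by apply/eqP; rewrite -subr_eq0 -opprB oppr_eq0 mulrA -{1}[z]mul1r -mulrBl Ps.
by rewrite -zE -mulrBr -opprB mulrN; apply: idealN => //; apply: idealM.
Qed.

End ideals.

(** * Linear independence and bases modulo a submodule *)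

Section linear_combinations.
Context {R : comNzRingType} {M : lmodType R}.
Implicit Types (m : set R) (W B : set M).

Definition lincomb (K : choiceType) (x : K -> M) (g : {malg R[K]}) : M :=
  \sum_(k <- msupp g) g@_k *: x k.

Lemma lincombEw (K : choiceType) (x : K -> M) (g : {malg R[K]}) (d : {fset K}) :
  (msupp g `<=` d)%fset -> lincomb x g = \sum_(k <- d) g@_k *: x k.
Proof.
move=> sgd; rewrite /lincomb; apply: big_fset_incl => // k _ /mcoeff_outdom->.
by rewrite scale0r.
Qed.

Fact lincomb_is_linear (K : choiceType) (x : K -> M) : linear (lincomb x).
Proof.
move=> a g h; pose d := (msupp g `|` msupp h `|` msupp (a *: g + h))%fset.
have sgd : (msupp g `<=` d)%fset by rewrite /d -fsetUA fsubsetUl.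
have shd : (msupp h `<=` d)%fset by rewrite /d fsetUAC fsubsetUr.
rewrite (lincombEw _ sgd) (lincombEw _ shd) (lincombEw _ (fsubsetUr _ _ : _ `<=` d)%fset).
rewrite scaler_sumr -big_split; apply: eq_bigr => k _ /=.
by rewrite mcoeffD mcoeffZ scalerDl scalerA.
Qed.

HB.instance Definition _ (K : choiceType) (x : K -> M) :=
  GRing.isLinear.Build R {malg R[K]} M *:%R (lincomb x) (lincomb_is_linear x).

Lemma lincombU (K : choiceType) (x : K -> M) c k : lincomb x << c *g k >> = c *: x k.
Proof. by rewrite (lincombEw _ msuppU_le) big_seq_fset1 mcoeffUU. Qed.

Lemma lincomb_sumU (K : choiceType) (x : K -> M) (I : Type) (s : seq I)
    (c : I -> R) (k : I -> K) :
  lincomb x (\sum_(i <- s) << c i *g k i >>) = \sum_(i <- s) c i *: x (k i).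
Proof. by rewrite linear_sum; apply: eq_bigr => i _; exact: lincombU. Qed.

Lemma mcoeff_sumU (K : choiceType) (I : eqType) (s : seq I) (c : I -> R)
    (h : I -> K) i : {in s &, injective h} -> uniq s -> i \in s ->
  (\sum_(j <- s) << c j *g h j >> : {malg R[K]})@_(h i) = c i.
Proof.
move=> inj_h uniq_s si; rewrite raddf_sum (bigD1_seq i) //= mcoeffUU big_seq_cond.
rewrite big1 ?addr0 // => j /andP[sj ji]; rewrite mcoeffU.
by case: eqP => // /inj_h jiE; rewrite jiE ?eqxx // in ji.
Qed.

Lemma mcoeff_sumU0 (K : choiceType) (I : eqType) (s : seq I) (c : I -> R)
    (h : I -> K) k : (forall i, i \in s -> h i <> k) ->
  (\sum_(j <- s) << c j *g h j >> : {malg R[K]})@_k = 0.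
Proof.
move=> hk; rewrite raddf_sum big_seq big1 //= => j /hk hjk; rewrite mcoeffU.
by case: eqP.
Qed.

Definition submod W := W 0 /\ forall a x y, W x -> W y -> W (a *: x + y).

(* Linear independence in [M / W] over [R / m]. *)
Definition free_mod m W (K : choiceType) (x : K -> M) :=
  forall g, W (lincomb x g) -> forall k, m g@_k.

Definition spans_mod W (K : choiceType) (x : K -> M) :=
  forall y, exists g, W (y - lincomb x g).

Definition supported B (g : {malg R[M]}) := forall v, g@_v != 0 -> B v.

(** The analogue of [free_mod] for a set indexed by itself, the form suited to Zorn's lemma;
    [free_mod_image] and [spans_mod_image] return to families. *)
Definition indep_mod m W B :=
  forall g, supported B g -> W (lincomb id g) -> forall v, m g@_v.

(** The quotient of [M] by [W] is a vector space over the residue field of [m], and a maximal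
    independent set containing [B0] is a basis of it. *)
Lemma extend_indep_mod m W B0 : maximal_ideal m -> submod W ->
  (forall a x, m a -> W (a *: x)) -> indep_mod m W B0 ->
  exists B, [/\ B0 `<=` B, indep_mod m W B &
    forall y, exists2 g, supported B g & W (y - lincomb id g)].
Proof.
move=> maxm [W0 Wl] mW indB0.
have WZ a x : W x -> W (a *: x) by move=> Wx; rewrite -[_ *: _]addr0; apply: Wl.
have WD x y : W x -> W y -> W (x + y).
  by move=> Wx Wy; rewrite -[x]scale1r; apply: Wl.
(* Only the part added to [B0] varies, so the empty chain yields [B0] itself. *)
pose P A := indep_mod m W (B0 `|` A).
have [F sFP totF|A [indA Amax]] := @Zorn_bigcup _ P.
  move=> g gF.
  have [X PX gX] : exists2 X, P X & forall v, v \in msupp g -> (B0 `|` X) v.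
    have : forall v, v \in msupp g -> (B0 `|` \bigcup_(X in F) X) v.
      by move=> v; rewrite -mcoeff_neq0; apply: gF.
    suff aux (s : seq M) : (forall v, v \in s -> (B0 `|` \bigcup_(X in F) X) v) ->
        exists2 X, F X \/ X = set0 & forall v, v \in s -> (B0 `|` X) v.
      move=> /aux[X FX gX]; exists X => //; case: FX => [/sFP//|->].
      by rewrite /P setU0.
    elim: s => [_|v s IHs sF]; first by exists set0; [right|].
    have [|X FX sX] := IHs; first by move=> w ws; apply: sF; rewrite inE ws orbT.
    case: (sF v (mem_head _ _)) => [B0v|[Y FY Yv]].
      by exists X => // w; rewrite inE => /predU1P[->|/sX//]; left.
    case: FX => [FX|X0]; last first.
      exists Y; first by left.
      move=> w; rewrite inE => /predU1P[->|/sX[]]; [by right | by left | by rewrite X0].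
    have [sXY|sYX] := totF _ _ FX FY.
      exists Y; first by left.
      move=> w; rewrite inE => /predU1P[->|/sX[]]; [by right | by left |].
      by move=> Xw; right; apply: sXY.
    exists X; first by left.
    by move=> w; rewrite inE => /predU1P[->|/sX//]; right; apply: sYX.
  by apply: PX => v; rewrite mcoeff_neq0; apply: gX.
exists (B0 `|` A); split; [by move=> y; left | exact: indA | move=> y].
case: (pselect ((B0 `|` A) y)) => [By|nBy].
  exists << 1 *g y >>; last by rewrite lincombU scale1r subrr.
  by move=> v; rewrite mcoeffU; case: (y =P v) => [<-//|_]; rewrite mulr0n eqxx.
have [g [gB [Wg [k mk]]]] : exists g,
    supported (B0 `|` (A `|` [set y])) g /\ W (lincomb id g) /\ exists k, ~ m g@_k.
  apply: contrapT => ng; apply: (Amax (A `|` [set y])).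
    by split=> [v|/(_ y (or_intror erefl)) Ay]; [left | apply: nBy; right].
  move=> g gB Wg k; apply: contrapT => mk; apply: ng.
  by exists g; split=> //; split=> //; exists k.
pose h := g - << g@_y *g y >>.
have hE v : h@_v = if y == v then 0 else g@_v.
  by rewrite mcoeffB mcoeffU; case: eqP => [->|_]; rewrite ?subrr ?subr0.
have hB : supported (B0 `|` A) h.
  move=> v; rewrite hE; case: (y =P v); first by rewrite eqxx.
  by move=> yv /gB[B0v|[Av|vy]]; [left | right | case: yv].
have lch : lincomb id h = lincomb id g - g@_y *: y by rewrite linearB /= lincombU.
have [mi _ mmax] := maxm.
(* With the coefficient of [y] in [m], [h] would be a nontrivial relation in the independent set. So
   this coefficient has an inverse [r], and [y] is congruent to [- r *: lincomb id h]. *)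
have /mmax[r mr] : ~ m g@_y.
  move=> my; have Wh : W (lincomb id h).
    by rewrite lch -scaleN1r scalerA addrC; apply: WD => //; apply: mW; apply: idealM.
  have := indA _ hB Wh k; rewrite hE.
  by case: (y =P k) => [yk _|_ /mk//]; apply: mk; rewrite -yk.
exists (- r *: h).
  by move=> v; rewrite mcoeffZ => rh; apply: hB; apply: contraNneq rh => ->; rewrite mulr0.
rewrite linearZ /= lch scaleNr opprK scalerBr scalerA addrCA -{1}[y]scale1r -scalerBl.
by apply: WD; [apply: WZ | apply: mW].
Qed.

Lemma free_mod_image m W B (K : choiceType) (h : K -> M) : ideal m ->
  injective h -> (forall k, B (h k)) -> indep_mod m W B -> free_mod m W h.
Proof.
move=> idm inj_h hB indB g Wg k.
have [gk|/mcoeff_outdom->] := boolP (k \in msupp g); last by case: idm.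
rewrite -(@mcoeff_sumU _ _ (msupp g) (fun k => g@_k) h k) //; last exact: in2W.
apply: indB; last by rewrite lincomb_sumU.
move=> v gv; apply: contrapT => nBv; move/eqP: gv; apply.
by apply: mcoeff_sumU0 => i _ hi; apply: nBv; rewrite -hi.
Qed.

Lemma spans_mod_image W B (K : choiceType) (h : K -> M) :
  (forall v, B v -> exists k, h k = v) ->
  (forall y, exists2 g, supported B g & W (y - lincomb id g)) -> spans_mod W h.
Proof.
move=> hB spB y; have [g gB Wg] := spB y.
have [g0|[v0 gv0]] := fset_0Vmem (msupp g).
  by exists 0; move: Wg; rewrite /lincomb g0 msupp0 !big_seq_fset0.
have [k0 _] : exists k, h k = v0 by apply/hB/gB; rewrite mcoeff_neq0.
have /choice[h' h'K] : forall v, exists k, B v -> h k = v.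
  by move=> v; case: (pselect (B v)) => [/hB[k <-]|nBv]; [exists k | exists k0].
exists (\sum_(v <- msupp g) << g@_v *g h' v >>); rewrite lincomb_sumU.
suff -> : \sum_(v <- msupp g) g@_v *: h (h' v) = lincomb id g by [].
apply: eq_big_seq => v; rewrite -mcoeff_neq0 => gv.
by rewrite h'K //; apply: gB.
Qed.

End linear_combinations.

(** * Bases of the function module modulo maximal ideals, and lifting along a composition series *)

Section function_module.
Context {R : comNzRingType} {L : Type}.
Implicit Types (m I : set R) (y : L -> R^o).

Definition fun_in I : set (L -> R^o) := [set y | forall l, I (y l)].

Lemma submod_fun_in I : ideal I -> submod (fun_in I).
Proof.
by move=> [I0 Il]; split=> [l|a y z Iy Iz l]; [exact: I0 | exact: Il].
Qed.

Lemma lincomb_fctE (K : choiceType) (x : K -> L -> R^o) g l :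
  lincomb x g l = \sum_(k <- msupp g) g@_k * x k l.
Proof. by rewrite /lincomb fct_sumE. Qed.

Lemma lincomb_mem I (K : choiceType) (x : K -> L -> R^o) g : ideal I ->
  (forall k, I g@_k) -> fun_in I (lincomb x g).
Proof.
move=> idI Ig l; rewrite lincomb_fctE; apply: ideal_sum => // k _.
by rewrite mulrC; apply: idealM.
Qed.

Lemma lincomb_congr m (K : choiceType) (x z : K -> L -> R^o) g : ideal m ->
  (forall k, fun_in m (x k - z k)) -> fun_in m (lincomb x g - lincomb z g).
Proof.
move=> idm mxz l; rewrite -[(_ - _) l]/(lincomb x g l - lincomb z g l).
rewrite !lincomb_fctE -sumrB; apply: ideal_sum => // k _.
by rewrite -mulrBr; apply: idealM => //; apply: mxz.
Qed.

(* The function [e X] is the indicator of the set of finite partial functions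
   that agree with [X]; as [L] is infinite, [g] enumerates these along [L]. *)
Lemma separating_functions : infinite_set [set: L] ->
  exists e : (L -> bool) -> (L -> R^o), forall X (s : seq (L -> bool)),
    X \notin s -> exists l, e X l = 1 /\ forall Y, Y \in s -> e Y l = 0.
Proof.
move=> /infinite_surj_seq[g gP].
exists (fun X l => (all (fun p => X p.1 == p.2) (g l))%:R) => X s Xs.
suff [t [tX tY]] : exists t : seq (L * bool), all (fun p => X p.1 == p.2) t /\
    forall Y, Y \in s -> ~~ all (fun p => Y p.1 == p.2) t.
  by have [l gl] := gP t; exists l; rewrite /= gl tX; split=> // Y /tY/negPf->.
elim: s Xs => [_|Y s IHs]; first by exists [::].
rewrite inE negb_or => /andP[/eqP XY /IHs[t [tX tY]]].
have [l /eqP XYl] : exists l, X l <> Y l.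
  apply: contra_notP XY => /forallNP XY; apply/funext => l.
  by apply: contrapT => XYl; apply: (XY l) => YXl; apply: XYl.
exists ((l, X l) :: t); split=> [|Z]; first by rewrite /= eqxx.
rewrite inE /= negb_and => /predU1P[->|/tY->]; last exact: orbT.
by rewrite eq_sym XYl.
Qed.

(** The indicators extend to a basis [B]. It contains [2^L] of them and lies in a set of at most
    [2^L] functions, so it can be indexed by [L -> bool]. *)
Lemma exists_basis_mod m : infinite_set [set: L] ->
  [set: R] #<= [set: nat -> bool] -> maximal_ideal m ->
  exists x : (L -> bool) -> (L -> R^o),
    free_mod m (fun_in m) x /\ spans_mod (fun_in m) x.
Proof.
move=> Linf leR maxm; have [idm _ _] := maxm.
have [e eP] := separating_functions Linf.
have inj_e : injective e.
  move=> X Y eXY; apply: contrapT => /eqP XY.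
  have [|l [eX /(_ Y (mem_head _ _))]] := eP X [:: Y]; first by rewrite inE.
  by rewrite -eXY eX => /eqP; rewrite oner_eq0.
have [e' e'K] : exists e', cancel e e' by apply: injective_left_inverse => //; exists; exact: (fun=> true).
have indE : indep_mod m (fun_in m) (range e).
  move=> g gE Wg v.
  have [gv|/mcoeff_outdom->] := boolP (v \in msupp g); last by case: idm.
  have e'v w : w \in msupp g -> e (e' w) = w.
    by rewrite -mcoeff_neq0 => /gE[X _ <-]; rewrite e'K.
  (* At a point where [v] is 1 and the rest of the support vanishes, the combination equals the
     coefficient of [v]. *)
  have [|l [evl ewl]] := eP (e' v) [seq e' w | w <- rem v (msupp g)].
    apply/mapP => -[w]; rewrite mem_rem_uniq ?fset_uniq // inE => /andP[/eqP wv gw].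
    by move=> /(congr1 e); rewrite !e'v // => /esym.
  have := Wg l; rewrite lincomb_fctE (bigD1_seq v) //= -{2}(e'v v gv) evl mulr1.
  rewrite big_seq_cond big1 ?addr0 // => w /andP[gw wv].
  rewrite -(e'v w gw) ewl ?mulr0 //; apply: map_f.
  by rewrite mem_rem_uniq ?fset_uniq // inE wv.
have mW a y : m a -> fun_in m (a *: y).
  by move=> ma l; rewrite -[(_ *: _) l]/(a * y l) mulrC; apply: idealM.
have [B [sEB indB spB]] := extend_indep_mod maxm (submod_fun_in idm) mW indE.
have /card_set_bijP[f [_ inj_f surj_f]] : B #= [set: L -> bool].
  rewrite card_eq_le; apply/andP; split.
    have [f inj_f] := fun_card_le Linf leR.
    by apply/pcard_injP; exists f; apply: in2W.
  have /card_esym/card_eqPle[le1 _] := @inj_card_eq _ _ setT e (in2W inj_e).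
  exact: card_le_trans le1 (subset_card_le sEB).
have /choice[h hP] : forall X, exists v, B v /\ f v = X.
  by move=> X; have [v Bv <-] := surj_f X I; exists v.
exists h; split.
  apply: free_mod_image indB => //; last by move=> X; case: (hP X).
  by move=> X Y hXY; case: (hP X) => _ <-; rewrite hXY; case: (hP Y).
apply: spans_mod_image spB => v Bv; exists (f v); have [Bh fh] := hP (f v).
by apply: inj_f; rewrite ?inE.
Qed.

Lemma free_composition_series (K : choiceType) (x : K -> L -> R^o) ms I g :
  composition_series ms I -> (forall m, m \in ms -> free_mod m (fun_in m) x) ->
  (forall k, I g@_k) -> lincomb x g = 0 -> g = 0.
Proof.
move=> cs; elim: cs g => [|ms' J a csJ IHJ maxJ] g free_x Ig lg0.
  by apply/malgP => k; rewrite mcoeff0; apply: Ig.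
have idJ := composition_series_ideal csJ.
apply: IHJ => // [m mms|k]; first by apply: free_x; rewrite inE mms orbT.
have /choice[t tP] : forall k, exists r, J (g@_k - r * a).
  by move=> j; have [r _ Jr] := Ig j; exists r.
(* Modulo [J], [g] is [a *: h], so [lincomb x h] has values in [colon J a]. Independence puts the
   coefficients of [h] there, hence those of [g] in [J]. *)
pose h : {malg R[K]} := \sum_(k <- msupp g) << t k *g k >>.
have Jgh j : J (g - a *: h)@_j.
  rewrite mcoeffB mcoeffZ; have [gj|gj] := boolP (j \in msupp g).
    by rewrite (@mcoeff_sumU _ _ _ _ t id) // mulrC.
  rewrite mcoeff_outdom // (@mcoeff_sumU0 _ _ _ _ t id) ?mulr0 ?subr0; first by case: idJ.
  by move=> i gi ij; rewrite -ij gi in gj.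
have free_colon := free_x (colon J a) (mem_head _ _).
have Jh : J (h@_k * a).
  apply: free_colon => l; rewrite /colon /= mulrC.
  have := lincomb_mem x idJ Jgh l; rewrite linearB linearZ /= lg0 sub0r.
  by move/(idealN idJ); rewrite -[(- _) l]/(- (a * lincomb x h l)) opprK.
by have := Jgh k; rewrite mcoeffB mcoeffZ [a * _]mulrC => /(idealBr idJ); apply.
Qed.

Lemma span_composition_series (K : choiceType) (x : K -> L -> R^o) ms I y :
  composition_series ms I -> (forall m, m \in ms -> spans_mod (fun_in m) x) ->
  fun_in I y -> exists g, lincomb x g = y.
Proof.
move=> cs; elim: cs y => [|ms' J a csJ IHJ maxJ] y span_x Iy.
  by exists 0; rewrite linear0; apply/funext => l; rewrite (Iy l).
have idJ := composition_series_ideal csJ.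
have /choice[z zP] : forall l, exists r, J (y l - r * a).
  by move=> l; have [r _ Jr] := Iy l; exists r.
have [h zh] := span_x (colon J a) (mem_head _ _) z.
(* Replacing [z] by [lincomb x h] errs by values in [colon J a], which [a] multiplies into [J]; the
   induction hypothesis covers the remainder. *)
have [m mms|l|g gE] := IHJ (y - a *: lincomb x h).
- by apply: span_x; rewrite inE mms orbT.
- rewrite -[(_ - _) l]/(y l - a * lincomb x h l).
  have -> : y l - a * lincomb x h l = (y l - z l * a) + (z l - lincomb x h l) * a.
    by rewrite mulrBl addrA subrK [a * _]mulrC.
  by apply: idealD; [exact: idJ | exact: zP | exact: (zh l)].
- by exists (g + a *: h); rewrite linearD linearZ /= gE subrK.
Qed.

End function_module.

(** * One basis from the bases modulo the maximal ideals *)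

Theorem theorem3p5 (R : comNzRingType) (L : Type) :
  artinian R ->
  [set: R] #<= [set: nat -> bool] ->
  infinite_set [set: L] ->
  free_module (L -> R^o)%type /\ has_dim (L -> R^o)%type (L -> bool)%type.
Proof.
move=> artR leR Linf.
suff dimK : has_dim (L -> R^o)%type (L -> bool)%type by split=> //; eexists; exact: dimK.
have [ms cs] := artinian_composition_series artR.
have maxms m : m \in ms -> maximal_ideal m by exact: composition_series_maximal cs.
(* The choice ranges over all sets [m]; those outside [ms] get the zero family as a dummy. *)
have /choice[V VP] : forall m, exists x : (L -> bool) -> (L -> R^o), m \in ms ->
    free_mod m (fun_in m) x /\ spans_mod (fun_in m) x.
  move=> m; case: (boolP (m \in ms)) => [/maxms mm|_]; last by exists (fun=> 0).
  by have [x xP] := exists_basis_mod Linf leR mm; exists x.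
have /choice[u uP] : forall p : (L -> bool) * L, exists z : R, forall m, m \in ms ->
    m (z - V m p.1 p.2) by move=> p; apply: chinese_maximal.
pose x k : L -> R^o := fun l => u (k, l).
have xV m g : m \in ms -> fun_in m (lincomb x g - lincomb (V m) g).
  move=> mms; apply: lincomb_congr => [|k l]; last exact: (uP (k, l) m mms).
  by case: (maxms m mms).
have free_x m : m \in ms -> free_mod m (fun_in m) x.
  move=> mms g xg; have [idm _ _] := maxms m mms; apply: (VP m mms).1 => l.
  exact: (idealBl idm (xV m g mms l)).
have span_x m : m \in ms -> spans_mod (fun_in m) x.
  move=> mms y; have [idm _ _] := maxms m mms; have [g yg] := (VP m mms).2 y.
  exists g => l; have := idealB idm (yg l) (xV m g mms l).
  by rewrite -![(_ - _) l]/(_ l - _ l) opprB addrA subrK.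
(* At the top ideal, the whole ring, membership is automatic: spanning gives a right inverse [F],
   and freeness a trivial kernel. *)
exists (lincomb x).
have /choice[F FK] : forall y, exists g, lincomb x g = y.
  by move=> y; apply: span_composition_series cs span_x _.
exists F => // g; apply/eqP; rewrite -subr_eq0; apply/eqP.
apply: free_composition_series cs free_x _ _ => //.
by rewrite linearB /= FK subrr.
Qed.
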